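(* For all $m,n\in\mathbb{N}$, the Hausdorff dimension of $\mathfrak{B}(m,n)$ equals $mn$.
   Context: Let $\mathbb{F}$ be the finite field with $k=p^r$ elements ($p$ prime, $r\ge 1$). Let $\mathcal{L}=\mathbb{F}((X^{-1}))$ be the field of formal Laurent series $\sum_{i=-n}^{\infty}a_{-i}X^{-i}$ ($a_i\in\mathbb{F}$), with absolute value $|x|=k^{n}$ if $x=\sum_{i=-n}^\infty a_{-i}X^{-i}$ with $a_n\neq 0$, and $|0|=0$. On $\mathcal{L}^h$ use the height $\|\mathbf{x}\|_\infty=\max_i|x_i|$ and the induced (ultrametric) metric; balls are balls for this metric. For $\mathbf{x}\in\mathcal{L}^h$ let $\langle\mathbf{x}\rangle=\min_{\mathbf{p}\in\mathbb{F}[X]^h}\|\mathbf{x}-\mathbf{p}\|_\infty$. Identify $m\times n$ matrices over $\mathcal{L}$ with $\mathcal{L}^{mn}$; $\mathbf{q}A$ is the usual vector–matrix product. Define $$\mathfrak{B}(m,n)=\{A\in\mathcal{L}^{mn}:\exists K>0\ \forall \mathbf{q}\in\mathbb{F}[X]^m\setminus\{0\}:\ \langle\mathbf{q}A\rangle^n>K/\|\mathbf{q}\|_\infty^m\}.$$ Hausdorff dimension on $\mathcal{L}^{mn}$ is defined as usual via covers by balls $B(\mathbf{c}_i,\rho_i)$ with $s$-length $\sum_i\rho_i^s$. *)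

(* Defs.v *)
From HB Require Import structures.
From mathcomp Require Import all_boot all_order all_algebra all_field.
From mathcomp Require Import all_classical all_reals ereal topology normedtype sequences exp.
Set Implicit Arguments. Unset Strict Implicit. Unset Printing Implicit Defensive.
Import Order.TTheory GRing.Theory Num.Theory.
Local Open Scope ring_scope.
Local Open Scope classical_set_scope.

Section Laurent.
Variable F : finFieldType.

(* A formal Laurent series  sum_{i <= N} c_i X^i  (in X^{-1}) is represented
   by its coefficient function c : int -> F (c i = coefficient of X^i),
   which vanishes for all sufficiently large i. *)
Definition laurent := {c : int -> F | exists N : int, forall i : int, N < i -> c i = 0}.

Definition lcoef (x : laurent) : int -> F := proj1_sig x.

Lemma lsub_proof (x y : laurent) :
  exists N : int, forall i : int, N < i -> lcoef x i - lcoef y i = 0.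
Proof.
case: x => [c [N HN]]; case: y => [d [M HM]] /=.
exists (Num.max N M) => i; rewrite gt_max => /andP[h1 h2].
by rewrite HN // HM // subrr.
Qed.
Definition lsub (x y : laurent) : laurent :=
  exist _ (fun i => lcoef x i - lcoef y i) (lsub_proof x y).

Lemma ladd_proof (x y : laurent) :
  exists N : int, forall i : int, N < i -> lcoef x i + lcoef y i = 0.
Proof.
case: x => [c [N HN]]; case: y => [d [M HM]] /=.
exists (Num.max N M) => i; rewrite gt_max => /andP[h1 h2].
by rewrite HN // HM // addr0.
Qed.
Definition ladd (x y : laurent) : laurent :=
  exist _ (fun i => lcoef x i + lcoef y i) (ladd_proof x y).

Lemma lzero_proof : exists N : int, forall i : int, N < i -> (0 : F) = 0.
Proof. by exists 0. Qed.
Definition lzero : laurent := exist _ (fun _ => 0) lzero_proof.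

Lemma lpoly_proof (p : {poly F}) : exists N : int, forall i : int, N < i ->
  (if (0 <= i) then p`_(absz i) else 0) = 0.
Proof.
exists (size p)%:Z => i hi.
case: ifP => // hi0; apply: nth_default.
by move: hi; rewrite -{1}(gez0_abs hi0) ltz_nat => /ltnW.
Qed.
Definition lpoly (p : {poly F}) : laurent :=
  exist _ (fun i : int => if (0 <= i) then p`_(absz i) else 0) (lpoly_proof p).

Lemma lmulp_proof (p : {poly F}) (x : laurent) :
  exists N : int, forall i : int, N < i ->
    \sum_(j < size p) p`_j * lcoef x (i - j%:Z) = 0.
Proof.
case: x => [c [N HN]] /=.
exists (N + (size p)%:Z) => i hi; apply: big1 => j _.
rewrite HN ?mulr0 //.
rewrite ltrBrDr; apply: le_lt_trans hi; idtac.
by rewrite lerD2l lez_nat ltnW.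
Qed.
Definition lmulp (p : {poly F}) (x : laurent) : laurent :=
  exist _ (fun i : int => \sum_(j < size p) p`_j * lcoef x (i - j%:Z))
        (lmulp_proof p x).

Variable R : realType.

Definition labs (x : laurent) : R :=
  xget 0 [set r : R | (lcoef x = (fun _ => 0) /\ r = 0) \/
     (exists n : int, lcoef x n != 0 /\ (forall i : int, n < i -> lcoef x i = 0)
                      /\ r = (#|F|%:R : R) ^ n)].

Definition hnorm (I : finType) (x : I -> laurent) : R :=
  \big[Num.max/0]_(i : I) labs (x i).

Definition dist_poly (I : finType) (x : I -> laurent) : R :=
  xget 0 [set r : R | exists p : I -> {poly F},
     r = hnorm (fun i => lsub (x i) (lpoly (p i))) /\
     forall p' : I -> {poly F}, r <= hnorm (fun i => lsub (x i) (lpoly (p' i)))].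

Definition vecmat (m n : nat) (q : 'I_m -> {poly F})
  (A : 'I_m * 'I_n -> laurent) : 'I_n -> laurent :=
  fun j => \big[ladd/lzero]_(i < m) lmulp (q i) (A (i, j)).

Definition Bad (m n : nat) : set ('I_m * 'I_n -> laurent) :=
  [set A | exists K : R, 0 < K /\ forall q : 'I_m -> {poly F}, (exists i, q i != 0) ->
     dist_poly (vecmat q A) ^+ n > K / (hnorm (fun i => lpoly (q i))) ^+ m].

Definition lball (I : finType) (c : I -> laurent) (r : R) : set (I -> laurent) :=
  [set y | hnorm (fun i => lsub (y i) (c i)) <= r].

(* A countable (finite or infinite) cover: a sequence of optional balls
   (center, radius) with radii in (0, delta]. *)
Definition is_cover (I : finType) (E : set (I -> laurent)) (delta : R)
  (B : nat -> option ((I -> laurent) * R)) : Prop :=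
  (forall k c r, B k = Some (c, r) -> 0 < r <= delta) /\
  E `<=` [set y | exists k c r, B k = Some (c, r) /\ lball c r y].

Definition slength (I : finType) (s : R) (B : nat -> option ((I -> laurent) * R)) : \bar R :=
  (\sum_(k <oo) (match B k with Some (_, r) => (r `^ s)%:E | None => 0%E end))%E.

Definition Hdelta (I : finType) (s delta : R) (E : set (I -> laurent)) : \bar R :=
  ereal_inf [set slength s B | B in is_cover E delta].

Definition Hmeasure (I : finType) (s : R) (E : set (I -> laurent)) : \bar R :=
  ereal_sup [set Hdelta s delta E | delta in [set d : R | 0 < d]].

Definition hausdorff_dim (I : finType) (E : set (I -> laurent)) : \bar R :=
  ereal_inf [set (s%:E)%E | s in [set s : R | 0 <= s /\ Hmeasure s E = 0%E]].

End Laurent.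

(* Main.v *)
(** Write A by its digits: the matrix A_t of coefficients of X^-(t+1). That a
    nonzero q of degree < r has qA within |X|^-l of a polynomial vector says that
    q is in the kernel of the block Hankel matrix (A_(a+t)), a < r, t < l; so A is
    badly approximable as soon as these kernels vanish along a sequence of shapes
    (r, l) = (n x, 4 + m x) with x in an arithmetic progression.

    Lower bound: reveal the digits in blocks of W = (m+n)M, and keep a node when
    the kernel conditions hold both for A and for its transpose. The condition on
    the transpose makes the wider Hankel matrices surjective, hence gives the exact
    size of their kernels, and a union bound over q shows that at least a fraction
    1/k of the k^(Wmn) children of a kept node is kept. For s < mn and M large this
    is at least k^(Ws), so a family of balls of small s-length can be avoided by
    going down the tree while keeping the s-length of the balls that meet the
    current cylinder below k^(-sL), L being the number of digits after the next block.

    Upper bound: the space is a countable union of unit balls around polynomial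
    vectors, each of which splits into k^(t mn) balls of radius k^-t. *)
Require Import Defs.
From HB Require Import structures.
From mathcomp Require Import all_boot all_order all_algebra all_field.
From mathcomp Require Import zify.
Set Implicit Arguments. Unset Strict Implicit. Unset Printing Implicit Defensive.
Import Order.TTheory GRing.Theory Num.Theory.
Local Open Scope ring_scope.

(** * Hankel kernels *)

Section Hankel.
Variable F : finFieldType.

(** A trivial kernel on columns means full column rank, hence a left inverse [N] of [M]. On row
    vectors [N] is a section of u -> uM, which is therefore onto. *)
Lemma right_inverse_of_adjoint_inj (I J : finType) (M : I -> J -> F) :
  (forall w : J -> F, (forall i, \sum_j M i j * w j = 0) -> forall j, w j = 0) ->
  exists N : J -> I -> F, forall j j', \sum_i N j i * M i j' = (j == j')%:R.
Proof.
move=> Minj.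
pose X : 'M[F]_(#|I|, #|J|) := \matrix_(i, j) M (enum_val i) (enum_val j).
have : row_free X^T.
  apply: inj_row_free => v vX0; apply/rowP => j; rewrite mxE.
  have := Minj (fun j => v 0 (enum_rank j)) _ (enum_val j).
  rewrite enum_valK; apply => i.
  have /rowP/(_ (enum_rank i)) := vX0; rewrite !mxE => E; rewrite -[RHS]E.
  rewrite [RHS](reindex (@enum_rank J)) /=; last exact: onW_bij (@enum_rank_bij J).
  by apply: eq_bigr => l _; rewrite !mxE !enum_rankK mulrC.
rewrite -row_leq_rank mxrank_tr => rkX.
have /row_fullP[B BX] : row_full X by rewrite -col_leq_rank.
exists (fun j i => B (enum_rank j) (enum_rank i)) => j j'.
have /matrixP/(_ (enum_rank j) (enum_rank j')) := BX.
rewrite !mxE (inj_eq enum_rank_inj) => <-.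
rewrite [RHS](reindex (@enum_rank I)) /=; last exact: onW_bij (@enum_rank_bij I).
by apply: eq_bigr => l _; rewrite !mxE !enum_rankK.
Qed.

(** With a section [N] of u -> uM, the map (u, v) -> u + vN is injective on solutions times
    [J]-vectors, because applying [M] gives b + v back. *)
Lemma card_affine_le (I J : finType) (M : I -> J -> F) (b : J -> F) :
  (forall w : J -> F, (forall i, \sum_j M i j * w j = 0) -> forall j, w j = 0) ->
  (#|[set u : {ffun I -> F} | [forall j, (\sum_i u i * M i j)%R == b j]]|
     * #|F| ^ #|J| <= #|F| ^ #|I|)%N.
Proof.
move=> /right_inverse_of_adjoint_inj[N NM].
set U := [set _ | _].
rewrite -(card_ffun J F) -(card_ffun I F) -cardsT -cardsX.
pose f (x : {ffun I -> F} * {ffun J -> F}) : {ffun I -> F} :=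
  [ffun i => x.1 i + \sum_j x.2 j * N j i].
have fM x j : x \in setX U setT -> \sum_i f x i * M i j = b j + x.2 j.
  rewrite !inE andbT => /forallP/(_ j)/eqP <-.
  under eq_bigr do rewrite ffunE mulrDl.
  rewrite big_split /=; congr (_ + _).
  under eq_bigr do rewrite mulr_suml.
  rewrite exchange_big /=.
  under eq_bigr => l _ do (under eq_bigr do rewrite -mulrA; rewrite -mulr_sumr NM).
  rewrite (bigD1 j) //= eqxx mulr1 big1 ?addr0 // => l /negPf ->.
  by rewrite mulr0.
rewrite -(@card_in_imset _ _ f) ?max_card // => x y xU yU fxy.
have e2 : x.2 = y.2.
  by apply/ffunP => j; apply: (@addrI _ (b j)); rewrite -!fM // fxy.
have e1 : x.1 = y.1.
  apply/ffunP => i; move/ffunP: fxy => /(_ i); rewrite !ffunE e2.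
  exact: addIr.
by case: x y e1 e2 {xU yU fxy} => [? ?] [? ?] /= -> ->.
Qed.

(** For q = sum_a q_a X^a of degree below [r], this is the coefficient of X^-(t+1) in entry [j] of
    qA. *)
Definition hankel m n r (q : nat -> 'I_m -> F) (A : nat -> 'I_m -> 'I_n -> F)
    (t : nat) (j : 'I_n) : F :=
  \sum_(x : 'I_r * 'I_m) q x.1 x.2 * A (x.1 + t)%N x.2 j.

(** In terms of approximation: <qA> >= k^-l for every nonzero q of degree below [r], with k =
    [#|F|]. *)
Definition hankel_inj m n r l (A : nat -> 'I_m -> 'I_n -> F) : Prop :=
  forall q : nat -> 'I_m -> F,
    (forall t j, (t < l)%N -> hankel r q A t j = 0) ->
    forall a i, (a < r)%N -> q a i = 0.

Definition digits_tr m n (A : nat -> 'I_m -> 'I_n -> F) : nat -> 'I_n -> 'I_m -> F :=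
  fun t j i => A t i j.

Lemma hankel_widen m n r r' (q : nat -> 'I_m -> F) (A : nat -> 'I_m -> 'I_n -> F) t j :
  (r <= r')%N -> (forall a i, (r <= a)%N -> q a i = 0) ->
  hankel r' q A t j = hankel r q A t j.
Proof.
move=> rr' q0; rewrite /hankel.
rewrite -(pair_bigA _ (fun (a : 'I_r') i => q a i * A (a + t)%N i j)) /=.
rewrite -(pair_bigA _ (fun (a : 'I_r) i => q a i * A (a + t)%N i j)) /=.
rewrite [RHS](big_ord_widen r' (fun a => \sum_i q a i * A (a + t)%N i j) rr').
rewrite [LHS](bigID (fun a : 'I_r' => (a < r)%N)) /= [X in _ + X]big1 ?addr0 //.
by move=> a; rewrite -leqNgt => ra; rewrite big1 // => i _; rewrite q0 // mul0r.
Qed.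

Lemma hankel_inj_mono m n r l r' l' (A : nat -> 'I_m -> 'I_n -> F) :
  (r' <= r)%N -> (l <= l')%N -> hankel_inj r l A -> hankel_inj r' l' A.
Proof.
move=> rr ll Ainj q qA a i ar'.
pose q' a i := if (a < r')%N then q a i else 0.
have := Ainj q' _ a i (leq_trans ar' rr); rewrite /q' ar'; apply => t j tl.
rewrite (@hankel_widen _ _ r') //; last by move=> b k; rewrite ltnNge => ->.
rewrite -(qA t j (leq_trans tl ll)); apply: eq_bigr => x _.
by rewrite /q' ltn_ord.
Qed.

Lemma eq_hankel m n r L (q : nat -> 'I_m -> F) (A B : nat -> 'I_m -> 'I_n -> F) t j :
  (forall t i j, (t < L)%N -> A t i j = B t i j) -> (r + t <= L)%N ->
  hankel r q A t j = hankel r q B t j.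
Proof.
move=> AB rtL; apply: eq_bigr => x _; rewrite AB //.
by apply: leq_trans rtL; rewrite ltn_add2r.
Qed.

(** The largest digit index read by the shape (r, l) is (r - 1) + (l - 1), hence the bound
    [L.+1]. *)
Lemma eq_hankel_inj m n r l L (A B : nat -> 'I_m -> 'I_n -> F) :
  (forall t i j, (t < L)%N -> A t i j = B t i j) -> (r + l <= L.+1)%N ->
  hankel_inj r l A -> hankel_inj r l B.
Proof.
move=> AB rlL Ainj q qB; apply: Ainj => t j tl.
by rewrite (eq_hankel _ _ AB) ?qB //; lia.
Qed.

(** A finite set, so that it can be counted; [hankel_inj] takes [nat]-indexed q instead, so that [r]
    can vary freely. *)
Definition hkernel m n r l (A : nat -> 'I_m -> 'I_n -> F) : {set {ffun 'I_r * 'I_m -> F}} :=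
  [set q : {ffun 'I_r * 'I_m -> F} | [forall y : 'I_l * 'I_n,
     \sum_(x : 'I_r * 'I_m) q x * A (x.1 + y.1)%N x.2 y.2 == 0]].

(** Transposing a block Hankel matrix gives the one of the transposed digits with the shape
    exchanged. The hypothesis thus makes the system onto, and rank-nullity bounds its kernel. *)
Lemma card_hkernel m n r l (A : nat -> 'I_m -> 'I_n -> F) :
  hankel_inj l r (digits_tr A) ->
  (#|hkernel r l A| * #|F| ^ (l * n) <= #|F| ^ (r * m))%N.
Proof.
move=> Ainj.
have := @card_affine_le ('I_r * 'I_m)%type ('I_l * 'I_n)%type
  (fun x y => A (x.1 + y.1)%N x.2 y.2) (fun=> 0) _.
rewrite !card_prod !card_ord; apply => w w0 [a j].
have := Ainj (fun b j => if insub b is Some b' then w (b', j) else 0) _ a j (ltn_ord a).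
rewrite valK; apply => t i tr.
rewrite -(w0 (Ordinal tr, i)); apply: eq_bigr => -[b c] _ /=.
by rewrite valK mulrC addnC.
Qed.

Definition ffun_digits m r (q : {ffun 'I_r * 'I_m -> F}) : nat -> 'I_m -> F :=
  fun a i => if insub a is Some a' then q (a', i) else 0.

Lemma ffun_digitsE m r (q : {ffun 'I_r * 'I_m -> F}) (x : 'I_r * 'I_m) :
  ffun_digits q x.1 x.2 = q x.
Proof. by case: x => a i; rewrite /ffun_digits valK. Qed.

Lemma ffun_digits_ge m r (q : {ffun 'I_r * 'I_m -> F}) a i :
  (r <= a)%N -> ffun_digits q a i = 0.
Proof. by move=> ra; rewrite /ffun_digits insubF // ltnNge ra. Qed.

Lemma hkernelP m n r l (A : nat -> 'I_m -> 'I_n -> F) (q : {ffun 'I_r * 'I_m -> F}) :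
  reflect (forall t j, (t < l)%N -> hankel r (ffun_digits q) A t j = 0)
    (q \in hkernel r l A).
Proof.
rewrite inE; apply: (iffP forallP) => [h t j tl|h [t j] /=].
  have /eqP <- := h (Ordinal tl, j).
  by apply: eq_bigr => x _; rewrite ffun_digitsE.
apply/eqP; rewrite -[RHS](h t j) //.
by apply: eq_bigr => x _; rewrite ffun_digitsE.
Qed.

Lemma card_hkernel_widen m n r l r' l' (A : nat -> 'I_m -> 'I_n -> F) :
  (r <= r')%N -> (l' <= l)%N -> (#|hkernel r l A| <= #|hkernel r' l' A|)%N.
Proof.
move=> rr ll.
pose f (q : {ffun 'I_r * 'I_m -> F}) : {ffun 'I_r' * 'I_m -> F} :=
  [ffun x : 'I_r' * 'I_m => ffun_digits q x.1 x.2].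
have f_inj : injective f.
  move=> p q /ffunP fpq; apply/ffunP => x.
  by have := fpq (widen_ord rr x.1, x.2); rewrite !ffunE !ffun_digitsE.
rewrite -(card_imset _ f_inj); apply/subset_leq_card/subsetP => _ /imsetP[q qk ->].
apply/hkernelP => t j tl; have /hkernelP/(_ t j) := qk => /(_ (leq_trans tl ll)) <-.
rewrite -(@hankel_widen m n r r') //; last exact: ffun_digits_ge.
by apply: eq_bigr => x _; rewrite ffun_digitsE ffunE.
Qed.

(** * Extension of a digit sequence by a block *)

Definition extend m n L W (A : nat -> 'I_m -> 'I_n -> F)
    (e : {ffun 'I_W * ('I_m * 'I_n) -> F}) : nat -> 'I_m -> 'I_n -> F :=
  fun t i j => if (t < L)%N then A t i j
               else if insub (t - L)%N is Some s then e (s, (i, j)) else 0.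

Lemma extend_lt m n L W (A : nat -> 'I_m -> 'I_n -> F)
    (e : {ffun 'I_W * ('I_m * 'I_n) -> F}) t i j :
  (t < L)%N -> extend L A e t i j = A t i j.
Proof. by rewrite /extend => ->. Qed.

(** Exhibits the affine dependence on [e]: the extension by zeros plus a linear part. *)
Lemma extendE m n L W (A : nat -> 'I_m -> 'I_n -> F)
    (e : {ffun 'I_W * ('I_m * 'I_n) -> F}) t i j :
  extend L A e t i j =
    extend L A ([ffun=> 0] : {ffun 'I_W * ('I_m * 'I_n) -> F}) t i j
    + \sum_(s < W) (L + s == t)%N%:R * e (s, (i, j)).
Proof.
rewrite /extend; case: ltnP => [tL|Lt].
  rewrite big1 ?addr0 // => s _; case: eqP => [E|_]; last by rewrite mul0r.
  by exfalso; lia.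
case: insubP => [s _ sE|].
  rewrite ffunE add0r (bigD1 s) //= sE subnKC // eqxx mul1r big1 ?addr0 // => s' ss'.
  case: eqP => [E|_]; last by rewrite mul0r.
  by case/negP: ss'; apply/eqP/val_inj; rewrite sE -E addKn.
rewrite -leqNgt => Wt; rewrite big1 ?addr0 // => s _.
case: eqP => [E|_]; last by rewrite mul0r.
by exfalso; have := ltn_ord s; lia.
Qed.

(* The top coefficient of q sits in front of a fresh digit of A at each of the
   positions t >= L + 1 - r, so every such coefficient of qA is an independent
   affine condition on the extension. *)
Lemma card_extend_hkernel m n r T L W (A : nat -> 'I_m -> 'I_n -> F)
    (q : nat -> 'I_m -> F) (i0 : 'I_m) :
  (forall a i, (r < a)%N -> q a i = 0) -> q r i0 != 0 ->
  (r + T <= L + W)%N ->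
  (#|[set e : {ffun 'I_W * ('I_m * 'I_n) -> F} |
       [forall y : 'I_T * 'I_n, hankel r.+1 q (extend L A e) y.1 y.2 == 0%R]]|
    * #|F| ^ ((T - (L - r)) * n) <= #|F| ^ (W * (m * n)))%N.
Proof.
(* [t0] is the first position t at which r + t, the index of the digit facing the leading
   coefficient, reaches [L] (0 if r >= L). Conditions at earlier positions are dropped. *)
move=> q0 qr rTLW; set t0 := (L - r)%N; set h := (T - t0)%N.
(* [c s i t] is the coefficient of the fresh digit [e (s, (i, j))] in the condition at t; [M] is the
   linear part of the system and [b] minus its constant part. *)
pose c (s : 'I_W) (i : 'I_m) (t : nat) : F := \sum_(a < r.+1) q a i * (L + s == a + t)%N%:R.
pose M (x : 'I_W * ('I_m * 'I_n)) (y : 'I_h * 'I_n) : F :=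
  (x.2.2 == y.2)%:R * c x.1 x.2.1 (t0 + y.1)%N.
pose e0 : {ffun 'I_W * ('I_m * 'I_n) -> F} := [ffun=> 0].
pose b (y : 'I_h * 'I_n) := - hankel r.+1 q (extend L A e0) (t0 + y.1)%N y.2.
have Madj (w : 'I_h * 'I_n -> F) :
    (forall i, \sum_j M i j * w j = 0) -> forall j, w j = 0.
  move=> w0 [t j].
  (* The system is triangular and is solved from the last position down: the fresh digit facing q_r
     at t would face an index above r at earlier positions, and later unknowns vanish by
     induction. *)
  have [d] := ubnP (h - t)%N; elim: d => // d IHd in t * => dt.
  have sW : (t0 + t + r - L < W)%N by have := ltn_ord t; rewrite /h /t0; lia.
  have := w0 (Ordinal sW, (i0, j)).
  rewrite (bigD1 (t, j)) //= big1 ?addr0.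
    rewrite /M /= eqxx mul1r /c big_ord_recr /= big1 ?add0r.
      rewrite (_ : (_ == _) = true) ?mulr1; last by apply/eqP; rewrite /t0; lia.
      by move/eqP; rewrite mulf_eq0 (negPf qr) /= => /eqP.
    move=> a _; rewrite (_ : (_ == _) = false) ?mulr0 //.
    by apply/negbTE/eqP; have := ltn_ord a; rewrite /t0; lia.
  move=> [t' j'] /= tj; rewrite /M /=; case: eqP => [jj'|_]; last by rewrite !mul0r.
  move: tj; rewrite -jj' xpair_eqE eqxx andbT mul1r => tt'.
  have [lt_t|ge_t] := ltnP t t'.
    by rewrite IHd ?mulr0 //; have := ltn_ord t'; lia.
  rewrite /c big1 ?mul0r // => a _.
  rewrite (_ : (_ == _) = false) ?mulr0 //.
  have {}tt' : nat_of_ord t' <> t by move=> E; case/negP: tt'; apply/eqP/val_inj.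
  by apply/negbTE/eqP; have := ltn_ord a; rewrite /t0 /=; lia.
have := card_affine_le b Madj.
rewrite !card_prod !card_ord; apply: leq_trans; rewrite leq_mul2r; apply/orP; right.
apply/subset_leq_card/subsetP => e; rewrite !inE => /forallP eq0; apply/forallP => -[t j].
have tT : (t0 + t < T)%N by have := ltn_ord t; rewrite /h; lia.
have := eq0 (Ordinal tT, j); rewrite /= /b /=.
move=> /eqP E; apply/eqP; rewrite -[RHS]add0r -[X in _ = X + _]E.
apply/(canRL (addrK _)); rewrite addrC.
transitivity (\sum_(x : 'I_r.+1 * 'I_m) (q x.1 x.2 * extend L A e0 (x.1 + (t0 + t))%N x.2 j
   + \sum_(s < W) q x.1 x.2 * ((L + s == x.1 + (t0 + t))%N%:R * e (s, (x.2, j))))); last first.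
  by apply: eq_bigr => x _; rewrite -mulr_sumr -mulrDr -extendE.
rewrite big_split /=; congr (_ + _).
transitivity (\sum_(s < W) \sum_(i < m) \sum_(l < n) e (s, (i, l)) * M (s, (i, l)) (t, j)).
  under [RHS]eq_bigr do rewrite pair_bigA /=.
  by rewrite [RHS]pair_bigA /=; apply: eq_bigr => -[s [i l]] _.
rewrite [RHS]exchange_big /=; apply: eq_bigr => s _.
rewrite -(pair_bigA _ (fun (a : 'I_r.+1) i =>
  q a i * ((L + s == a + (t0 + t))%N%:R * e (s, (i, j))))) /=.
rewrite [RHS]exchange_big /=; apply: eq_bigr => i _.
rewrite (bigD1 j) //= [X in _ + X]big1 ?addr0; last first.
  by move=> l /negPf lj; rewrite /M /= lj mul0r mulr0.
rewrite /M /= eqxx mul1r /c mulr_sumr; apply: eq_bigr => a _.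
by rewrite mulrCA; congr (_ * _); rewrite mulrC.
Qed.

End Hankel.

(** * Counting the bad extensions *)

Section BadExtensions.
Variable F : finFieldType.

Lemma card_bigcup_le (I T : finType) (P : pred I) (B : I -> {set T}) :
  (#|\bigcup_(i | P i) B i| <= \sum_(i | P i) #|B i|)%N.
Proof.
elim/big_rec2: _ => [|i n A _ IH]; first by rewrite cards0.
by rewrite (leq_trans (leq_card_setU _ _)) // leq_add2l.
Qed.

Lemma hankel_injP m n r l (A : nat -> 'I_m -> 'I_n -> F) :
  reflect (hankel_inj r l A) (hkernel r l A \subset [set [ffun=> 0]]).
Proof.
apply: (iffP subsetP) => [h q qA a i ar|h q /hkernelP qA].
  have := h [ffun x : 'I_r * 'I_m => q x.1 x.2] _.
  rewrite !inE => /(_ _)/eqP/ffunP/(_ (Ordinal ar, i)); rewrite !ffunE; apply.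
  apply/forallP => -[t j]; apply/eqP; rewrite -[RHS](qA t j) //.
  by apply: eq_bigr => x _; rewrite ffunE.
rewrite inE; apply/eqP/ffunP => -[a i]; rewrite ffunE.
by rewrite -(ffun_digitsE q); apply: (h _ qA).
Qed.

(** A geometric sum of ratio at least 2 is at most k times its last term k^(R m). *)
Lemma sum_expn_le k R m r1 : (1 < k)%N -> (0 < m)%N ->
  (\sum_(r1 <= r < R) k ^ (r.+1 * m) <= k ^ (R * m).+1)%N.
Proof.
move=> k1 m0; elim: R => [|R IH]; first by rewrite big_geq.
have [r1R|Rr1] := leqP r1 R; last by rewrite big_geq.
rewrite big_nat_recr //=.
apply: (leq_trans (leq_add IH (leqnn _))).
have : (k ^ (R * m).+1 <= k ^ (R.+1 * m))%N by rewrite leq_exp2l // mulSn; lia.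
rewrite (expnS k (R.+1 * m)); set X := (k ^ (R.+1 * m))%N; set Y := (k ^ _)%N.
move=> YX; apply: (@leq_trans (2 * X)); first by lia.
by rewrite leq_mul2r k1 orbT.
Qed.

(* [r] is the degree of a kernel element [q]. It is at least [n * x] because the
   kernel of degree below [n * x] was already trivial, and the leading
   coefficients of [qA] only involve the digits of [A] fixed so far. *)
Lemma bad_extend_cover m n x M (A : nat -> 'I_m -> 'I_n -> F) :
  let R := (n * (x + M))%N in
  let T := (4 + m * (x + M))%N in
  let L := (3 + (m + n) * x)%N in
  let W := ((m + n) * M)%N in
  hankel_inj (n * x) (4 + m * x) A ->
  [set e : {ffun 'I_W * ('I_m * 'I_n) -> F} |
     ~~ (hkernel R T (extend L A e) \subset [set [ffun=> 0]])] \subset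
  \bigcup_(r < R | (n * x <= r)%N)
   \bigcup_(q in [set q in hkernel r.+1 (L - r) A | [exists i, q (ord_max, i) != 0]])
     [set e : {ffun 'I_W * ('I_m * 'I_n) -> F} | [forall y : 'I_T * 'I_n,
        hankel r.+1 (ffun_digits q) (extend L A e) y.1 y.2 == 0]].
Proof.
move=> R T L W Ainj; apply/subsetP => e; rewrite inE => /subsetPn[q qk].
rewrite inE => q0; set B := extend L A e.
have BA t i j : (t < L)%N -> A t i j = B t i j by move=> tL; rewrite /B extend_lt.
(* [L] is exactly the number of digits read by the shape (n x, 4 + m x), so the hypothesis survives
   the extension; the extra equations up to [T] only help. *)
have Binj : hankel_inj (n * x) T B.
  apply: hankel_inj_mono (leqnn _) _ (eq_hankel_inj BA _ Ainj).
    by rewrite /T leq_add2l leq_mul2l leq_addr orbT.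
  by rewrite /L; lia.
have /existsP[r1 r1P] : [exists a : 'I_R, [exists i, q (a, i) != 0]].
  apply: contraNT q0 => /existsPn q0; apply/eqP/ffunP => -[a i]; rewrite ffunE.
  by have /existsPn/(_ i) := q0 a; rewrite negbK => /eqP.
case: (@arg_maxnP _ r1 (fun a : 'I_R => [exists i, q (a, i) != 0]) (fun a => nat_of_ord a) r1P).
move=> r /existsP[i0 qr0] rmax.
have qr a i : (r < a)%N -> ffun_digits q a i = 0.
  move=> ra; rewrite /ffun_digits; case: insubP => // b _ ba.
  apply/eqP/negPn/negP => qbi; have /rmax : [exists i, q (b, i) != 0] by apply/existsP; exists i.
  by rewrite /= leqNgt -[nat_of_ord b]/(val b) ba ra.
have hB t j : (t < T)%N -> hankel r.+1 (ffun_digits q) B t j = 0.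
  move=> tT; rewrite -(@hankel_widen _ _ _ r.+1 R) ?ltn_ord //.
  by have /hkernelP := qk; apply.
have nxr : (n * x <= r)%N.
  rewrite leqNgt; apply/negP => rnx; case/negP: qr0; apply/eqP.
  rewrite -(ffun_digitsE q) /=; apply: (Binj _ _ _ _ rnx) => t j tT.
  by rewrite (@hankel_widen _ _ _ r.+1) // hB.
apply/bigcupP; exists r => //.
pose q' : {ffun 'I_r.+1 * 'I_m -> F} := [ffun y : 'I_r.+1 * 'I_m => ffun_digits q y.1 y.2].
have q'q (C : nat -> 'I_m -> 'I_n -> F) t j :
    hankel r.+1 (ffun_digits q') C t j = hankel r.+1 (ffun_digits q) C t j :> F.
  by apply: eq_bigr => y _; rewrite ffun_digitsE ffunE.
apply/bigcupP; exists q'.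
  rewrite inE; apply/andP; split.
    apply/hkernelP => t j tL; rewrite q'q (eq_hankel _ _ BA); last by lia.
    apply: hB; apply: leq_trans tL _; rewrite /L /T; nia.
  by apply/existsP; exists i0; rewrite ffunE (ffun_digitsE q (r, i0)).
by rewrite inE; apply/forallP => -[t j]; rewrite q'q hB.
Qed.

(* For [r >= n * x + 3] the kernel size is given by rank-nullity, thanks to the
   hypothesis on the transpose: this gains the factor [#|F| ^ (4 * n)] that
   absorbs the sum over [r]. The three remaining degrees contribute at most
   [3 * #|F| ^ (4 * m)] candidates, which is negligible once [M >= 9]. *)
Lemma card_bad_extend m n x M (A : nat -> 'I_m -> 'I_n -> F) :
  (0 < m)%N -> (0 < n)%N -> (9 <= M)%N ->
  hankel_inj (n * x) (4 + m * x) A ->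
  hankel_inj (m * x) (4 + n * x) (digits_tr A) ->
  (#|[set e : {ffun 'I_((m + n) * M) * ('I_m * 'I_n) -> F} |
     ~~ (hkernel (n * (x + M)) (4 + m * (x + M)) (extend (3 + (m + n) * x) A e)
           \subset [set [ffun=> 0%R]])]|
   * #|F| ^ 2 <= #|F| ^ ((m + n) * M * (m * n)))%N.
Proof.
move=> m0 n0 M9 Ainj Atinj.
have k1 : (1 < #|F|)%N by rewrite finNzRing_gt1.
have k0 : (0 < #|F|)%N by apply: ltnW.
have := bad_extend_cover M Ainj => /=.
set R := (n * (x + M))%N; set T := (4 + m * (x + M))%N.
set L := (3 + (m + n) * x)%N; set W := ((m + n) * M)%N.
set k := #|F| in k1 k0 *; set X := (k ^ (W * (m * n)))%N.
pose Q r := [set q in hkernel r.+1 (L - r) A | [exists i, q (ord_max, i) != 0]].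
pose Z r (q : {ffun 'I_r.+1 * 'I_m -> F}) :=
  [set e : {ffun 'I_W * ('I_m * 'I_n) -> F} | [forall y : 'I_T * 'I_n,
        hankel r.+1 (ffun_digits q) (extend L A e) y.1 y.2 == 0]].
pose g r := (\sum_(q in Q r) #|Z r q|)%N.
move=> /subset_leq_card /leq_trans/(_ (card_bigcup_le _ _)) cbad.
have {}cbad : (#|[set e : {ffun 'I_W * ('I_m * 'I_n) -> F} |
     ~~ (hkernel R T (extend L A e) \subset [set [ffun=> 0%R]])]|
     <= \sum_(n * x <= r < R) g r)%N.
  rewrite big_geq_mkord; apply: (leq_trans cbad); apply: leq_sum => r _.
  exact: card_bigcup_le.
have gle r D c : (r < R)%N -> (#|hkernel r.+1 (L - r) A| <= D)%N ->
    (c <= T - (L - r))%N -> (g r * k ^ (c * n) <= D * X)%N.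
  move=> rR QD cT; rewrite /g big_distrl /=.
  apply: (@leq_trans (#|Q r| * X)); last first.
    rewrite leq_mul2r; apply/orP; right; apply: leq_trans QD.
    by apply/subset_leq_card/subsetP => q; rewrite inE => /andP[].
  rewrite -sum_nat_const; apply: leq_sum => q; rewrite inE => /andP[_ /existsP[i qi]].
  have := @card_extend_hkernel F m n r T L W A (ffun_digits q) i.
  rewrite -[ffun_digits q r i]/(ffun_digits q (@ord_max r, i).1 (@ord_max r, i).2).
  rewrite ffun_digitsE => /(_ _ qi) H; apply: leq_trans (H _ _).
  - by rewrite leq_mul2l leq_exp2l // leq_mul2r cT !orbT.
  - by move=> a j ra; apply: ffun_digits_ge.
  - by move: rR; rewrite /R /T /L /W; nia.
(* For these low degrees the shape is enlarged to (4 + n x, m x), where [card_hkernel] applies and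
   leaves at most k^(4m) elements. *)
have gA r : (n * x <= r < n * x + 3)%N -> (g r * k ^ (m * M * n) <= k ^ (4 * m) * X)%N.
  move=> /andP[r1 r2]; apply: gle; first by rewrite /R; nia.
    apply: leq_trans (card_hkernel_widen A (_ : _ <= 4 + n * x)%N (_ : m * x <= _)%N) _.
    - by lia.
    - by rewrite /L; lia.
    have := card_hkernel Atinj; rewrite -/k mulnDl expnD.
    by rewrite (_ : n * x * m = m * x * n)%N ?leq_pmul2r ?expn_gt0 ?k0 //; lia.
  by rewrite /T /L; nia.
(* The kernel saves the exponent (L - r) n and the extensions save (T - (L - r)) n; together they
   save T n. *)
have gB r : (n * x + 3 <= r < R)%N -> (g r * k ^ (T * n) <= k ^ (r.+1 * m) * X)%N.
  move=> /andP[r1 r2].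
  have kk := @card_hkernel F m n r.+1 (L - r) A _; rewrite -/k in kk.
  have LT : (L - r <= T)%N by rewrite /L /T; nia.
  rewrite -(subnK LT) mulnDl expnD mulnA.
  apply: (leq_trans (leq_mul (gle r _ _ r2 (leqnn _) (leqnn _)) (leqnn _))).
  rewrite mulnAC leq_mul2r kk ?orbT //.
  by apply: hankel_inj_mono Atinj; rewrite /L; lia.
pose sA := (\sum_(n * x <= r < n * x + 3) g r)%N.
pose sB := (\sum_(n * x + 3 <= r < R) g r)%N.
have sAB : (\sum_(n * x <= r < R) g r = sA + sB)%N.
  by rewrite (@big_cat_nat _ _ _ (n * x + 3)) ?leq_addr // /R; nia.
have hA : (sA * k ^ 3 <= X)%N.
  have h : (sA * k ^ (m * M * n) <= 3 * (k ^ (4 * m) * X))%N.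
    rewrite /sA big_distrl /= big_nat.
    apply: (@leq_trans (\sum_(n * x <= r < n * x + 3) k ^ (4 * m) * X)).
      by rewrite [leqRHS]big_nat; apply: leq_sum => r; apply: gA.
    by rewrite sum_nat_const_nat addKn.
  (* Here 9 <= M enters: 3 <= k^2 and 4m + 5 <= 9m <= m M n. *)
  rewrite -(@leq_pmul2l (k ^ (4 * m + 2))) ?expn_gt0 ?k0 //.
  apply: (@leq_trans (sA * k ^ (m * M * n))).
    rewrite mulnCA -expnD leq_mul2l leq_exp2l //; apply/orP; right; nia.
  apply: (leq_trans h); rewrite mulnA leq_mul2r; apply/orP; right.
  rewrite expnD mulnC leq_mul2l; apply/orP; right.
  by rewrite expnS expn1; nia.
have hB : (sB * k ^ 3 <= X)%N.
  have h : (sB * k ^ (T * n) <= k ^ (R * m).+1 * X)%N.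
    apply: leq_trans (leq_mul (sum_expn_le R (n * x + 3) k1 m0) (leqnn _)).
    rewrite /sB !big_distrl /= big_nat [leqRHS]big_nat.
    by apply: leq_sum => r; apply: gB.
  (* Here the 4 in [T] enters: R m + 4 <= T n. *)
  rewrite -(@leq_pmul2l (k ^ (R * m).+1)) ?expn_gt0 ?k0 //.
  apply: leq_trans h; rewrite mulnCA -expnD leq_mul2l leq_exp2l //.
  by apply/orP; right; rewrite /T /R; nia.
rewrite -(@leq_pmul2r k) // -mulnA -expnSr.
apply: (@leq_trans ((sA + sB) * k ^ 3)); first by rewrite leq_mul2r -sAB cbad orbT.
rewrite mulnDl; apply: (@leq_trans (X * 2)); first by lia.
by rewrite leq_mul2l k1 orbT.
Qed.

(** Reduces the condition on the transpose to the count with [m] and [n] exchanged. *)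
Definition transpose_ext m n W (e : {ffun 'I_W * ('I_m * 'I_n) -> F}) :
    {ffun 'I_W * ('I_n * 'I_m) -> F} :=
  [ffun x : 'I_W * ('I_n * 'I_m) => e (x.1, (x.2.2, x.2.1))].

Lemma transpose_ext_inj m n W : injective (@transpose_ext m n W).
Proof.
move=> e f /ffunP ef; apply/ffunP => -[s [i j]].
by have := ef (s, (j, i)); rewrite !ffunE.
Qed.

Lemma digits_tr_extend m n L W (A : nat -> 'I_m -> 'I_n -> F)
    (e : {ffun 'I_W * ('I_m * 'I_n) -> F}) t i j :
  extend L (digits_tr A) (transpose_ext e) t i j = digits_tr (extend L A e) t i j.
Proof.
rewrite /digits_tr /extend; case: ifP => // _.
by case: insubP => // s _ _; rewrite ffunE.
Qed.

(** Both shapes read exactly 3 + (m + n)(x + M) digits: those of [A] before the block and those of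
    [e]. *)
Definition good_ext m n x M (A : nat -> 'I_m -> 'I_n -> F)
    (e : {ffun 'I_((m + n) * M) * ('I_m * 'I_n) -> F}) :=
  (hkernel (n * (x + M)) (4 + m * (x + M)) (extend (3 + (m + n) * x) A e)
     \subset [set [ffun=> 0%R]]) &&
  (hkernel (m * (x + M)) (4 + n * (x + M)) (digits_tr (extend (3 + (m + n) * x) A e))
     \subset [set [ffun=> 0%R]]).

(** Each of the two conditions fails for a fraction at most k^-2 of the extensions, and 1 - 2/k^2 >=
    1/k because k >= 2. *)
Lemma card_good_ext m n x M (A : nat -> 'I_m -> 'I_n -> F) :
  (0 < m)%N -> (0 < n)%N -> (9 <= M)%N ->
  hankel_inj (n * x) (4 + m * x) A ->
  hankel_inj (m * x) (4 + n * x) (digits_tr A) ->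
  (#|F| ^ ((m + n) * M * (m * n)) <= #|[set e | good_ext x (M := M) A e]| * #|F|)%N.
Proof.
move=> m0 n0 M9 Ainj Atinj.
have k1 : (1 < #|F|)%N by rewrite finNzRing_gt1.
have b1 := card_bad_extend m0 n0 M9 Ainj Atinj.
have b2 := card_bad_extend n0 m0 M9 Atinj Ainj.
rewrite [(n + m)%N]addnC [(n * m)%N]mulnC in b2.
set X := (#|F| ^ ((m + n) * M * (m * n)))%N in b1 b2 *; set G := [set _ | _].
move: b2 b1 => b2'; set B1 := [set _ | _] => b1.
pose B2 := [set e : {ffun 'I_((m + n) * M) * ('I_m * 'I_n) -> F} |
  ~~ (hkernel (m * (x + M)) (4 + n * (x + M)) (digits_tr (extend (3 + (m + n) * x) A e))
     \subset [set [ffun=> 0%R]])].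
have b2 : (#|B2| * #|F| ^ 2 <= X)%N.
    apply: leq_trans b2'; rewrite leq_mul2r; apply/orP; right.
  rewrite -(card_imset _ (@transpose_ext_inj m n ((m + n) * M))).
  apply/subset_leq_card/subsetP => _ /imsetP[e eB ->].
  move: eB; rewrite !inE; apply: contra => /hankel_injP h; apply/hankel_injP.
  apply: (@eq_hankel_inj _ _ _ _ _ ((m * (x + M)) + (4 + n * (x + M)))) h => //.
  by move=> t i j _; apply: digits_tr_extend.
have : (X <= #|G| + (#|B1| + #|B2|))%N.
  rewrite /X (_ : _ ^ _ = #|{: {ffun 'I_((m + n) * M) * ('I_m * 'I_n) -> F}}|)%N; last first.
    by rewrite card_ffun !card_prod !card_ord.
  apply: leq_trans (leq_add (leqnn _) (leq_card_setU _ _)).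
  apply: leq_trans (leq_card_setU _ _).
  rewrite -cardsT; apply/subset_leq_card/subsetP => e _.
  by rewrite !inE /good_ext; case: (_ \subset _); case: (_ \subset _).
move: b1 b2 k1 {b2'}; rewrite expnS expn1.
move: #|F| #|G| #|B1| #|B2| X => k g x1 x2 X b1 b2 k1 Xle.
rewrite -(@leq_pmul2r k); last by lia.
have : (X * (k * k) <= g * k * k + (x1 * (k * k) + x2 * (k * k)))%N.
  by rewrite -mulnA -!mulnDl leq_mul2r Xle orbT.
have : (X * k + X * 2 <= X * (k * k))%N.
  by rewrite -mulnDr leq_mul2l; apply/orP; right; nia.
lia.
Qed.

End BadExtensions.

(** * Laurent series *)

From mathcomp Require Import all_classical all_reals ereal topology normedtype sequences exp.
From mathcomp Require Import esum.
Import Order.TTheory GRing.Theory Num.Theory.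
Local Open Scope ring_scope.

Section LaurentTheory.
Local Open Scope classical_set_scope.
Variables (F : finFieldType) (R : realType).
Local Notation k := (#|F|%:R : R).
Local Notation labs := (@labs F R).

Lemma card_field_gt1 : 1 < k.
Proof. by rewrite ltr1n finNzRing_gt1. Qed.

Lemma card_field_gt0 : 0 < k.
Proof. exact: lt_trans ltr01 card_field_gt1. Qed.

Lemma laurent_top (x : laurent F) i0 : lcoef x i0 != 0 ->
  exists n : int, lcoef x n != 0 /\ forall i, n < i -> lcoef x i = 0.
Proof.
case: (svalP x) => N; rewrite -/(lcoef x) => HN xi0.
have i0N : i0 <= N by rewrite leNgt; apply: contraNN xi0 => /HN ->.
have : exists d : nat, lcoef x (N - d%:Z) != 0.
  by exists `|N - i0|%N; rewrite gez0_abs ?subr_ge0 // subKr.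
move=> /ex_minnP[d xd dmin]; exists (N - d%:Z); split => // i di.
apply/eqP/negPn/negP => xi.
have iN : i <= N by rewrite leNgt; apply: contraNN xi => /HN ->.
have := dmin `|N - i|%N; rewrite gez0_abs ?subr_ge0 // subKr => /(_ xi).
lia.
Qed.

(** Resolves the choice in [labs]: a series is zero or has a top nonzero coefficient. *)
Lemma labs_spec (x : laurent F) :
  (lcoef x = (fun _ => 0) /\ labs x = 0) \/
  exists n : int, [/\ lcoef x n != 0, (forall i, n < i -> lcoef x i = 0)
    & labs x = k ^ n].
Proof.
rewrite /Defs.labs; set P := (X in xget _ X).
have /(xgetPex 0) : exists r, P r.
  have [/eqP x0|/eqP] := eqVneq (lcoef x) (fun=> 0).
    by exists 0; left; split => //; apply/eqP.
  move=> x0; have [i0 xi0] : exists i, lcoef x i != 0.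
    apply: contrapT => h; apply: x0; apply/funext => i.
    by apply/eqP/negPn/negP => xi; apply: h; exists i.
  have [n [xn nmax]] := laurent_top xi0.
  by exists (k ^ n); right; exists n.
by case=> [[h1 h2]|[n [h1 [h2 h3]]]]; [left|right; exists n].
Qed.

Lemma labs_ge0 (x : laurent F) : 0 <= labs x.
Proof.
case: (labs_spec x) => [[_ ->]//|[n [_ _ ->]]].
by rewrite exprz_ge0 // ltW // card_field_gt0.
Qed.

Lemma labs_ge (x : laurent F) i : lcoef x i != 0 -> k ^ i <= labs x.
Proof.
move=> xi; case: (labs_spec x) => [[x0 _]|[n [_ nmax ->]]].
  by rewrite x0 eqxx in xi.
apply: ler_weXz2l; first exact: ltW card_field_gt1.
rewrite leNgt; apply: contraNN xi => /nmax ->.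
exact: eqxx.
Qed.

Lemma labs_le (x : laurent F) N : (forall i, N < i -> lcoef x i = 0) -> labs x <= k ^ N.
Proof.
move=> xN; case: (labs_spec x) => [[_ ->]|[n [xn _ ->]]].
  by rewrite exprz_ge0 // ltW // card_field_gt0.
apply: ler_weXz2l; first exact: ltW card_field_gt1.
rewrite leNgt; apply: contraNN xn => /xN ->.
exact: eqxx.
Qed.

Lemma labs_mono (x y : laurent F) :
  (forall i, lcoef y i = 0 -> lcoef x i = 0) -> labs x <= labs y.
Proof.
move=> yx; case: (labs_spec y) => [[y0 ->]|[n [_ nmax ->]]].
  case: (labs_spec x) => [[_ -> //]|[i [/eqP]]].
  by rewrite yx ?y0.
by apply: labs_le => i /nmax; apply: yx.
Qed.

Lemma hnorm_ge (I : finType) (x : I -> laurent F) i : labs (x i) <= hnorm R x.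
Proof. exact: le_bigmax. Qed.

Lemma hnorm_le (I : finType) (x : I -> laurent F) r :
  0 <= r -> (forall i, labs (x i) <= r) -> hnorm R x <= r.
Proof. by move=> r0 xr; apply: bigmax_le. Qed.

Lemma mk_laurent_proof (p : {poly F}) (d : nat -> F) : exists N : int, forall i : int, N < i ->
  (match i with Posz a => p`_a | Negz t => d t end) = 0.
Proof.
exists (size p)%:Z => -[a|t] // hi; apply: nth_default.
by move: hi; rewrite ltz_nat => /ltnW.
Qed.

(* [Negz t] is the integer -(t+1): the digit [d t] is the coefficient of X^-(t+1). *)
Definition mk_laurent (p : {poly F}) (d : nat -> F) : laurent F :=
  exist _ (fun i : int => match i with Posz a => p`_a | Negz t => d t end) (mk_laurent_proof p d).

Lemma poly_part (x : laurent F) : exists p : {poly F}, forall a : nat, p`_a = lcoef x a%:Z.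
Proof.
case: (svalP x) => N; rewrite -/(lcoef x) => HN.
exists (\poly_(i < `|N|.+1) lcoef x i%:Z) => a; rewrite coef_poly.
case: ltnP => // Na; rewrite HN //; lia.
Qed.

(** The minimum is attained at the polynomial parts, so [xget] does return it; subtracting
    polynomials never alters the coefficient of X^-(t+1). *)
Lemma dist_poly_ge (I : finType) (x : I -> laurent F) i t :
  lcoef (x i) (Negz t) != 0 -> k ^ (Negz t) <= dist_poly R x.
Proof.
move=> xit; rewrite /dist_poly; set P := (X in xget _ X).
have : exists r, P r.
  have /choice[p pE] : forall i, exists p : {poly F}, forall a : nat, p`_a = lcoef (x i) a%:Z.
    by move=> ?; exact: poly_part.
  exists (hnorm R (fun i => lsub (x i) (lpoly (p i)))), p; split => // p'.
  apply: hnorm_le => [|j]; first exact: le_trans (labs_ge0 _) (hnorm_ge _ i).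
  apply: le_trans (hnorm_ge _ j); apply: labs_mono => -[a|s] /=.
    by move=> _; rewrite pE subrr.
  by [].
move=> /(xgetPex 0)[p [-> _]].
apply: le_trans (hnorm_ge _ i); apply: labs_ge => /=.
by rewrite subr0.
Qed.

Definition digit_point m n (a : nat -> 'I_m -> 'I_n -> F) : 'I_m * 'I_n -> laurent F :=
  fun x => mk_laurent 0 (fun t => a t x.1 x.2).

Lemma lcoef_sum (I : Type) (r : seq I) (f : I -> laurent F) c :
  lcoef (\big[@ladd F/@lzero F]_(i <- r) f i) c = \sum_(i <- r) lcoef (f i) c.
Proof. by elim/big_rec2: _ => //= i y1 y2 _ <-. Qed.

Lemma lcoef_vecmat m n (q : 'I_m -> {poly F}) (a : nat -> 'I_m -> 'I_n -> F) r t j :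
  (forall i, (size (q i) <= r)%N) ->
  lcoef (vecmat q (digit_point a) j) (Negz t) = hankel r (fun b i => (q i)`_b) a t j.
Proof.
move=> qr; rewrite lcoef_sum /hankel.
rewrite -(pair_bigA _ (fun (b : 'I_r) i => (q i)`_b * a (b + t)%N i j)) /=.
rewrite exchange_big /=; apply: eq_bigr => i _.
transitivity (\sum_(b < size (q i)) (q i)`_b * a (b + t)%N i j).
  apply: eq_bigr => b _; congr (_ * _).
  by rewrite (_ : Negz t - b%:Z = Negz (b + t)); last lia.
rewrite (big_ord_widen r (fun b => (q i)`_b * a (b + t)%N i j) (qr i)) big_mkcond /=.
by apply: eq_bigr => b _; case: ltnP => // qb; rewrite nth_default ?mul0r.
Qed.

(** For q of degree d, take the least x with d < n M x. Some digit of qA at a position below 4 + m M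
    x is nonzero, and n M x <= d + n M turns this into a bound against k^(-d m). *)
Lemma digit_point_Bad m n M (a : nat -> 'I_m -> 'I_n -> F) :
  (0 < m)%N -> (0 < n)%N -> (0 < M)%N ->
  (forall x, hankel_inj (n * (M * x)) (4 + m * (M * x)) a) ->
  Bad R (digit_point a).
Proof.
move=> m0 n0 M0 ainj.
have kX e : 0 < k ^+ e by rewrite exprn_gt0 // card_field_gt0.
(* From n (4 + m M x) <= 4n + m d + m n M; the successor makes the inequality strict. *)
exists (k ^+ (4 * n + m * n * M).+1)^-1; split; first by rewrite invr_gt0.
move=> q [i0 qi0].
case: (@arg_maxnP _ i0 xpredT (fun i => size (q i)) isT) => i1 _ i1max.
set d := (size (q i1)).-1.
have sd i : (size (q i) <= d.+1)%N.
  by apply: leq_trans (leqSpred _); exact: i1max.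
have qd : (q i1)`_d != 0.
  rewrite -/(lead_coef (q i1)) lead_coef_eq0 -size_poly_gt0.
  by apply: leq_trans (i1max i0 isT); rewrite size_poly_gt0.
pose x := (d %/ (n * M)).+1.
have dx : (d < n * (M * x))%N by rewrite mulnA mulnC ltn_ceil // muln_gt0 n0.
have xd : (n * (M * x) <= d + n * M)%N.
  by rewrite mulnA /x mulnS addnC leq_add2r mulnC leq_trunc_div.
have [t [j [tlt nz]]] : exists t j, (t < 4 + m * (M * x))%N /\
    hankel (n * (M * x)) (fun b i => (q i)`_b) a t j != 0.
  apply: contrapT => h; case/negP: qd; apply/eqP.
  apply: (ainj x (fun b i => (q i)`_b)) dx => t j tl.
  by apply/eqP/negPn/negP => nz; apply: h; exists t, j.
rewrite -lcoef_vecmat in nz; last by move=> i; apply: leq_trans (sd i) dx.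
set D := dist_poly R _; set h := hnorm R _.
have hD : (k ^+ (4 + m * (M * x)))^-1 <= D.
  apply: le_trans (dist_poly_ge nz); rewrite NegzE -exprz_inv -exprnP exprVn.
  rewrite lef_pV2 ?posrE // ler_weXn2l //; exact: ltW card_field_gt1.
have hh : k ^+ d <= h.
  apply: le_trans (hnorm_ge _ i1); rewrite exprnP; apply: labs_ge => /=.
  exact: qd.
apply: (@le_lt_trans _ _ ((k ^+ (4 * n + m * n * M).+1)^-1 / (k ^+ d) ^+ m)).
  have h0 : 0 < h := lt_le_trans (kX d) hh.
  rewrite ler_pM2l ?invr_gt0 // lef_pV2 ?posrE ?exprn_gt0 ?card_field_gt0 //.
  by rewrite lerXn2r // nnegrE ltW.
apply: (@lt_le_trans _ _ ((k ^+ (4 + m * (M * x)))^-1 ^+ n)); last first.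
  have i0' : 0 <= (k ^+ (4 + m * (M * x)))^-1 by rewrite invr_ge0 ltW.
  by rewrite lerXn2r // nnegrE //; apply: le_trans hD.
rewrite -invfM exprVn -!exprM -exprD ltf_pV2 ?posrE // ltr_eXn2l ?card_field_gt1 //.
nia.
Qed.

End LaurentTheory.

(** * Lower bound *)

Section LowerBound.
Local Open Scope classical_set_scope.
Variables (F : finFieldType) (R : realType).
Local Notation k := (#|F|%:R : R).

Lemma exists_lt_average (T : finType) (G : {set T}) (mu : T -> \bar R) (theta : R) (S : \bar R) :
  (\sum_(e in G) mu e <= S)%E -> (S < (#|G|%:R * theta)%:E)%E ->
  exists2 e, e \in G & (mu e < theta%:E)%E.
Proof.
move=> muS Slt; apply: contrapT => h.
have : (\sum_(e in G) theta%:E <= \sum_(e in G) mu e)%E.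
  apply: lee_sum => e eG; rewrite leNgt; apply/negP => lt; apply: h; by exists e.
rewrite sumEFin sumr_const -mulr_natl => /le_trans/(_ muS)/le_lt_trans/(_ Slt).
by rewrite ltxx.
Qed.

(** For t < N a discrepancy with the centre at X^-(t+1) has size at least k^-N > r, so the ball
    prescribes these digits. *)
Lemma lball_point_digits m n (c : 'I_m * 'I_n -> laurent F) r N
    (b b' : nat -> 'I_m -> 'I_n -> F) :
  r < (k ^+ N)^-1 -> lball c r (digit_point b) -> lball c r (digit_point b') ->
  forall t i j, (t < N)%N -> b t i j = b' t i j.
Proof.
move=> rN br b'r t i j tN.
have kN : (k ^+ N)^-1 <= k ^ Negz t.
  rewrite NegzE -exprz_inv -exprnP exprVn lef_pV2 ?posrE ?exprn_gt0 ?card_field_gt0 //.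
  by rewrite ler_weXn2l // ltW // card_field_gt1.
have eqc (d : nat -> 'I_m -> 'I_n -> F) : lball c r (digit_point d) ->
    d t i j = lcoef (c (i, j)) (Negz t).
  move=> dr; apply/eqP; rewrite -subr_eq0; apply/negPn/negP => nz.
  have := @labs_ge F R (lsub (digit_point d (i, j)) (c (i, j))) (Negz t) nz.
  apply/negP; rewrite -ltNge; apply: le_lt_trans
    (@hnorm_ge F R _ (fun x => lsub (digit_point d x) (c x)) (i, j)) _.
  by apply: le_lt_trans dr _; apply: lt_le_trans rN kN.
by rewrite (eqc _ br) (eqc _ b'r).
Qed.

(** * Descent through the tree of good nodes, avoiding a given family of balls *)

Section Walk.
Variables (m n M : nat) (s : R) (B : nat -> option (('I_m * 'I_n -> laurent F) * R)).
Hypothesis (m0 : (0 < m)%N) (n0 : (0 < n)%N) (M9 : (9 <= M)%N).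
Hypothesis (s0 : 0 <= s).
Hypothesis sM : ((m + n) * M)%:R * s + 1 <= ((m + n) * M * (m * n))%:R.
Hypothesis Bpos : forall i c r, B i = Some (c, r) -> 0 < r.

Let L j := (3 + (m + n) * (M * j))%N.
Let theta j : R := (k ^+ L j)^-1 `^ s.
Let cost i : \bar R := match B i with Some (_, r) => (r `^ s)%:E | None => 0%E end.

(** Ball [i] meets the cylinder of digit points that share their first [N] digits with [a]. *)
Let meets N (a : nat -> 'I_m -> 'I_n -> F) i : Prop :=
  match B i with
  | Some (c, r) => exists b : nat -> 'I_m -> 'I_n -> F,
      (forall t x y, (t < N)%N -> b t x y = a t x y) /\ lball c r (digit_point b)
  | None => False
  end.

Let mass N a : \bar R := (\sum_(i <oo) (if `[< meets N a i >] then cost i else 0%E))%E.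

Let cost_ge0 i : (0 <= cost i)%E.
Proof. by rewrite /cost; case: (B i) => [[c r]|//]; rewrite lee_fin powR_ge0. Qed.

Let term_ge0 N a i : (0 <= (if `[< meets N a i >] then cost i else 0))%E.
Proof. by case: ifP. Qed.

(** A ball of radius at least k^-L(j+1) would by itself cost [theta j.+1], more than the whole
    mass. *)
Let meets_small j a i c r : (mass (L j) a < (theta j.+1)%:E)%E -> meets (L j) a i ->
  B i = Some (c, r) -> r < (k ^+ L j.+1)^-1.
Proof.
move=> mlt mi Bi; rewrite ltNge; apply/negP => rge.
move: mlt; apply/negP; rewrite -leNgt.
apply: (@le_trans _ _ (cost i)).
  rewrite /cost Bi lee_fin; apply: ge0_ler_powR => //.
    by rewrite nnegrE invr_ge0 exprn_ge0 // ltW // card_field_gt0.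
  by rewrite nnegrE ltW // (Bpos Bi).
have := @nneseries_lim_ge R (fun i => if `[< meets (L j) a i >] then cost i else 0%E) xpredT 0 i.+1
  (fun i _ _ => term_ge0 _ _ i).
apply: le_trans; rewrite big_nat_recr //= asboolT // leeDr //.
by apply: sume_ge0 => l _; apply: term_ge0.
Qed.

Let thetaS j : theta j = (k ^+ ((m + n) * M)) `^ s * theta j.+1.
Proof.
have kX e : 0 <= k ^+ e by rewrite exprn_ge0 // ltW // card_field_gt0.
rewrite /theta -powRM ?invr_ge0 //; congr (_ `^ s).
rewrite (_ : L j.+1 = (m + n) * M + L j)%N; last by rewrite /L; lia.
move: (L j) => l; rewrite exprD invfM mulrA mulfV ?mul1r // expf_neq0 // gt_eqF //.
exact: card_field_gt0.
Qed.

(** This is [sM] exponentiated: a fraction 1/k of the children of a node still amounts to at least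
    k^(W s), with W = (m + n) M. *)
Let powR_card_le : (k ^+ ((m + n) * M)) `^ s * k <= k ^+ ((m + n) * M * (m * n)).
Proof.
have k0 := @card_field_gt0 F R; have k0' := ltW k0.
rewrite -powR_mulrn // -powRrM -[X in _ * X]powRr1 //.
rewrite -powRD ?(gt_eqF k0) ?implybT //.
by rewrite -powR_mulrn // ler_powR // ltW // card_field_gt1.
Qed.

(** The mass is compared with [theta] one level ahead, so that [meets_small] yields balls too small
    to meet two children. *)
Let inv j a := [/\ hankel_inj (n * (M * j)) (4 + m * (M * j)) a,
  hankel_inj (m * (M * j)) (4 + n * (M * j)) (digits_tr a) &
  (mass (L j) a < (theta j.+1)%:E)%E].

(* A ball meeting the cylinder is so small that it meets at most one child, so
   the masses of the good children add up to at most the mass of the parent. *)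
Let inv_step j a : inv j a ->
  exists e : {ffun 'I_((m + n) * M) * ('I_m * 'I_n) -> F}, inv j.+1 (extend (L j) a e).
Proof.
move=> [ainj atinj amass].
have Gcard := card_good_ext m0 n0 M9 ainj atinj.
set G := finset _ in Gcard.
have sumG : (\sum_(e in G) mass (L j.+1) (extend (L j) a e) <= mass (L j) a)%E.
  rewrite /mass -nneseries_sum; last by move=> *; apply: term_ge0.
  apply: lee_nneseries => [i _ _|i _]; first by apply: sume_ge0 => *; apply: term_ge0.
  have [[e1 [e1G me1]]|none] := pselect (exists e, e \in G /\ meets (L j.+1) (extend (L j) a e) i);
    last first.
    rewrite big1 ?term_ge0 // => e eG; rewrite asboolF // => me; apply: none; by exists e.
  case Bi : (B i) (me1) => [[c r]|]; rewrite {1}/meets Bi // => -[b1 [b1e b1r]].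
  have ma : meets (L j) a i.
    rewrite /meets Bi; exists b1; split => // t x y tL.
    rewrite b1e ?extend_lt //; apply: leq_trans tL _; rewrite /L; nia.
  rewrite (bigD1 e1) //= big1 ?adde0.
    by rewrite (asboolT me1) (asboolT ma).
  (* Another child met by the same ball would agree with [e1] on all the fresh digits. *)
  move=> e2 /andP[_ e21]; rewrite asboolF // /meets Bi => -[b2 [b2e b2r]].
  case/negP: e21; apply/eqP/ffunP => -[u [x y]].
  have Lu : (L j + u < L j.+1)%N by have := ltn_ord u; rewrite /L; nia.
  have := lball_point_digits (meets_small amass ma Bi) b2r b1r x y Lu.
  rewrite b1e // b2e // /extend ltnNge leq_addr /= addKn.
  by rewrite valK.
(* The number of good children makes up for the ratio of [theta j.+1] to [theta j.+2]. *)
have ltG : (mass (L j) a < (#|G|%:R * theta j.+2)%:E)%E.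
  apply: lt_le_trans amass _; rewrite lee_fin thetaS.
  apply: ler_wpM2r; first exact: powR_ge0.
  rewrite -(ler_pM2r (@card_field_gt0 F R)); apply: le_trans powR_card_le _.
  by rewrite -natrX -natrM ler_nat.
have [e eG elt] := exists_lt_average sumG ltG.
exists e; move: eG; rewrite inE => /andP[/hankel_injP e1 /hankel_injP e2].
by split => //; rewrite mulnSr.
Qed.

(** The nested nodes have a limit [a]. A ball containing it meets every cylinder on the path, so its
    radius is below every k^-L(j+1), which no positive radius is. *)
Lemma walk_avoids : (\sum_(i <oo) cost i < (theta 1)%:E)%E ->
  exists a : nat -> 'I_m -> 'I_n -> F, Bad R (digit_point a) /\
    forall i c r, B i = Some (c, r) -> ~ lball c r (digit_point a).
Proof.
move=> tot.
(* A total choice of the next block, with the zero block as default where the invariant fails. *)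
have /choice[eps epsP] : forall ja : nat * (nat -> 'I_m -> 'I_n -> F), exists e, inv ja.1 ja.2 ->
    inv ja.1.+1 (extend (L ja.1) ja.2 (e : {ffun 'I_((m + n) * M) * ('I_m * 'I_n) -> F})).
  move=> [j a] /=; have [/inv_step[e h]|h] := pselect (inv j a); first by exists e.
  by exists [ffun=> 0].
pose a_ := fix a_ j := if j is j'.+1 then extend (L j') (a_ j') (eps (j', a_ j'))
                       else (fun _ _ _ => 0).
have a_inv j : inv j (a_ j).
  elim: j => [|j IH]; last exact: (epsP (j, a_ j)).
  (* At level 0 the kernels have no unknowns, and the mass is at most the total cost. *)
  split; rewrite ?muln0 //.
  apply: le_lt_trans tot; apply: lee_nneseries => [i _ _|i _]; first exact: term_ge0.
  by case: ifP.
have a_stable j d t x y : (t < L j)%N -> a_ (j + d)%N t x y = a_ j t x y.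
  move=> tL; elim: d => [|d IH]; first by rewrite addn0.
  by rewrite addnS /= extend_lt //; apply: leq_trans tL _; rewrite /L; nia.
have tLt t : (t < L t)%N.
  rewrite /L mulnA; apply: (@leq_trans (3 + t)); first by lia.
  by rewrite leq_add2l leq_pmull // muln_gt0 addn_gt0 m0 (leq_trans _ M9).
(* Since t < L t, digit t is settled by level t. *)
pose a t := a_ t t.
have aE j t x y : (t < L j)%N -> a t x y = a_ j t x y.
  move=> tL; rewrite /a; have [jt|/ltnW tj] := leqP j t.
    by rewrite -(subnKC jt) a_stable // subnKC.
  rewrite -(subnKC tj) a_stable //.
exists a; split.
  apply: (@digit_point_Bad F R m n M) => // [|x]; first by apply: leq_trans M9.
  have [h _ _] := a_inv x.
  apply: (@eq_hankel_inj _ _ _ _ _ (L x)) h => [t i j tL|]; first by rewrite (aE x).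
  by rewrite /L; lia.
move=> i c r Bi ar.
have r0 := Bpos Bi.
have rlt j : r < (k ^+ L j.+1)^-1.
  have [_ _ h] := a_inv j; apply: (meets_small h _ Bi).
  by rewrite /meets Bi; exists a; split => // t x y tL; rewrite (aE j).
have [N] : exists N : nat, r^-1 < N%:R.
  by exists (Num.bound r^-1); apply: archi_boundP; rewrite invr_ge0 ltW.
apply/negP; rewrite -leNgt.
apply: (@le_trans _ _ (k ^+ L N.+1)); last first.
  by rewrite -[leLHS]invrK lef_pV2 ?posrE ?invr_gt0 ?exprn_gt0 ?card_field_gt0 // ltW.
rewrite -natrX ler_nat; apply: ltnW; apply: leq_trans (ltn_expl _ (finNzRing_gt1 F)).
by apply: leq_trans (tLt _); lia.
Qed.

End Walk.

(** A cover of s-length below the constant, which is [theta 1] of the walk, would miss a point of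
    [Bad]; the constant does not depend on [delta]. *)
Lemma slength_Bad_ge m n (s : R) : (0 < m)%N -> (0 < n)%N -> 0 <= s -> s < (m * n)%:R ->
  exists2 c : R, 0 < c & forall delta B, is_cover (@Bad F R m n) delta B ->
    (c%:E <= slength s B)%E.
Proof.
move=> m0 n0 s0 smn.
have [N Nlt] : exists N : nat, ((m * n)%:R - s)^-1 < N%:R.
  exists (Num.bound ((m * n)%:R - s)^-1); apply: archi_boundP.
  by rewrite invr_ge0 subr_ge0 ltW.
(* The counting needs M >= 9; M (mn - s) >= 1 pays for the factor 1/k lost in each block. *)
pose M := maxn 9 N.
have sM : ((m + n) * M)%:R * s + 1 <= ((m + n) * M * (m * n))%:R :> R.
  have d0 : 0 < (m * n)%:R - s :> R by rewrite subr_gt0.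
  rewrite (natrM _ ((m + n) * M)) -lerBrDl -mulrBr -ler_pdivrMr // mul1r.
  apply: le_trans (ltW Nlt) _; rewrite ler_nat.
  by apply: leq_trans (leq_maxr 9 N) _; rewrite -/M leq_pmull // addn_gt0 m0.
exists (((k ^+ (3 + (m + n) * (M * 1)))^-1) `^ s).
  by rewrite powR_gt0 // invr_gt0 exprn_gt0 // card_field_gt0.
move=> delta B [Br BE]; rewrite leNgt; apply/negP => lt.
have Bpos i c r : B i = Some (c, r) -> 0 < r by move=> /Br /andP[].
have [a [abad aB]] := walk_avoids m0 n0 (leq_maxl 9 N) s0 sM Bpos lt.
by have [i [c [r [Bi ar]]]] := BE _ abad; apply: (aB i c r).
Qed.

End LowerBound.

(** * Upper bound *)

Section UpperBound.
Local Open Scope classical_set_scope.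
Variables (F : finFieldType) (R : realType).
Local Notation k := (#|F|%:R : R).

Lemma exists_expV_le (z : R) : 0 < z -> exists t : nat, (k ^+ t)^-1 <= z.
Proof.
move=> z0; exists (Num.bound z^-1).
rewrite -[leRHS]invrK lef_pV2 ?posrE ?invr_gt0 ?exprn_gt0 ?card_field_gt0 //.
apply: le_trans (ltW (archi_boundP _)) _; first by rewrite invr_ge0 ltW.
by rewrite -natrX ler_nat ltnW // ltn_expl // finNzRing_gt1.
Qed.

(** The s-length of the k^(t N) balls of radius k^-t that fill a unit ball in dimension [N]. *)
Lemma card_powR_expV (N t : nat) (s : R) :
  (k ^+ t) ^+ N * (k ^+ t)^-1 `^ s = (k ^+ t)^-1 `^ (s - N%:R).
Proof.
have z0 : 0 < (k ^+ t)^-1 by rewrite invr_gt0 exprn_gt0 // card_field_gt0.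
rewrite -[in RHS](addrC (- N%:R)) powRD ?(gt_eqF z0) ?implybT //; congr (_ * _).
by rewrite powRN powR_mulrn ?ltW // exprVn invrK.
Qed.

(** * Covers by balls centred at truncated series *)

Section Cover.
Variable I : finType.

Definition grid_center t (P : {ffun I -> {poly F}}) (d : {ffun I * 'I_t -> F}) : I -> laurent F :=
  fun x => mk_laurent (P x) (fun a => if insub a is Some a' then d (x, a') else 0).

(** [P] collects the polynomial parts and is chosen before [t], since the cover lets the precision
    depend on the code of [P]. *)
Lemma grid_center_near (y : I -> laurent F) : exists P, forall t,
  exists d : {ffun I * 'I_t -> F}, lball (grid_center P d) ((k ^+ t)^-1) y.
Proof.
have /choice[p pE] : forall i, exists p : {poly F}, forall a : nat, p`_a = lcoef (y i) a%:Z.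
  by move=> ?; exact: poly_part.
exists [ffun x => p x] => t; exists [ffun x : I * 'I_t => lcoef (y x.1) (Negz x.2)].
apply: hnorm_le => [|x]; first by rewrite invr_ge0 exprn_ge0 // ltW // card_field_gt0.
rewrite exprnN; apply: labs_le => -[a|a] lt /=.
  by rewrite ffunE pE subrr.
have at' : (a < t)%N by lia.
by rewrite insubT ffunE subrr.
Qed.

(* The unit ball around the polynomial vector with code [p] is cut into
   [#|F| ^ (tau p * #|I|)] balls of total cost [rad p `^ (s - #|I|) <= eps / 2 ^ p.+1]. *)
Lemma exists_small_cover (E : set (I -> laurent F)) (s eps delta : R) :
  #|I|%:R < s -> 0 < eps -> 0 < delta ->
  exists2 B, is_cover E delta B & (slength s B <= eps%:E)%E.
Proof.
move=> Is eps0 delta0; pose sig := s - #|I|%:R.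
have sig0 : 0 < sig by rewrite subr_gt0.
have /choice[tau tauP] : forall p : nat, exists t : nat,
    (k ^+ t)^-1 <= Num.min delta ((eps / (2 ^ p.+1)%N%:R) `^ sig^-1).
  by move=> p; apply: exists_expV_le; rewrite lt_min delta0 powR_gt0 // divr_gt0 //.
pose rad p := (k ^+ tau p)^-1.
have rad0 p : 0 < rad p by rewrite invr_gt0 exprn_gt0 // card_field_gt0.
pose D p := {ffun I * 'I_(tau p) -> F}.
(* [e] enumerates the pairs (code of a polynomial vector, rank of a digit table); pairs that code
   nothing give [None]. *)
have /card_esym/pcard_eqP[e] := card_nat2.
have [e' eK e'K] : bijective e := bijTT.
pose B (i : nat) : option ((I -> laurent F) * R) :=
  if (unpickle (e i).1 : option {ffun I -> {poly F}}) is Some P then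
    if (insub (e i).2 : option 'I_(#|D (e i).1|)) is Some v then
      Some (grid_center P (enum_val v), rad (e i).1)
    else None
  else None.
exists B.
  split.
    move=> i c r; rewrite /B; case: unpickle => // P; case: insub => // v [_ <-].
    by rewrite rad0 /=; have := tauP (e i).1; rewrite le_min => /andP[].
  move=> y _; have [P] := grid_center_near y; pose p := pickle P.
  move=> /(_ (tau p))[d yd].
  exists (e' (p, nat_of_ord (enum_rank d))), (grid_center P d), (rad p); split => //.
  by rewrite /B e'K /= pickleK valK enum_rankK.
pose J p := `I_(#|D p|).
(* Numbers that code no polynomial vector are charged too, which gives a complete double sum. *)
have costB i : (match B i with Some (_, r) => (r `^ s)%:E | None => 0%E end <=
    (if e i \in [set: nat] `*`` J then (rad (e i).1 `^ s)%:E else 0))%E.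
  rewrite /B; case: unpickle => [P|]; last by case: ifP => //; rewrite lee_fin powR_ge0.
  case: insubP => [v vlt _|_]; last by case: ifP => //; rewrite lee_fin powR_ge0.
  by rewrite mem_set.
apply: (@le_trans _ _ (\sum_(i <oo)
    (if e i \in [set: nat] `*`` J then (rad (e i).1 `^ s)%:E else 0))%E).
  apply: lee_nneseries => [i _ _|i _]; last exact: costB.
  by case: (B i) => [[c r]|]; rewrite ?lee_fin ?powR_ge0.
(* Unordered sums allow reindexing by [e] into a series over p of finite sums over [J p]. *)
rewrite nneseries_esumT; last by move=> i; case: ifP => _ //; rewrite lee_fin powR_ge0.
rewrite -(reindex_esum [set: nat] [set: nat * nat] e
  (fun x => if x \in [set: nat] `*`` J then (rad x.1 `^ s)%:E else 0%E)); last exact: bij.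
rewrite -esum_mkcond -(@esum_esum _ _ _ _ J (fun p _ => (rad p `^ s)%:E)); last first.
  by move=> *; rewrite lee_fin powR_ge0.
rewrite -nneseries_esumT; last by move=> p; apply: esum_ge0 => *; rewrite lee_fin powR_ge0.
apply: le_trans (@epsilon_trick0 R eps xpredT (ltW eps0)).
apply: lee_nneseries => [p _ _|p _]; first by apply: esum_ge0 => *; rewrite lee_fin powR_ge0.
rewrite esum_fset; last 2 first.
- exact: finite_II.
- by move=> *; rewrite lee_fin powR_ge0.
rewrite -fsbig_ord sumEFin sumr_const card_ord card_ffun card_prod card_ord.
rewrite -(mulr_natl (rad p `^ s)) (natrX _ #|F|) (mulnC #|I|) exprM card_powR_expV lee_fin -/sig.
have := tauP p; rewrite le_min => /andP[_ h].
set z := eps / _ in h *.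
have z0 : 0 < z by rewrite divr_gt0 // ltr0n expn_gt0.
have -> : z = (z `^ sig^-1) `^ sig.
  by rewrite -powRrM mulVf ?gt_eqF // powRr1 // ltW.
by apply: ge0_ler_powR => //; rewrite ?nnegrE ?powR_ge0 ?ltW //; exact: rad0.
Qed.

End Cover.

Lemma slength_ge0 (I : finType) (s : R) (B : nat -> option ((I -> laurent F) * R)) :
  (0 <= slength s B)%E.
Proof.
apply: nneseries_ge0 => i _ _.
by case: (B i) => [[c r]|]; rewrite ?lee_fin ?powR_ge0.
Qed.

Lemma Hmeasure_eq0 (I : finType) (E : set (I -> laurent F)) (s : R) :
  #|I|%:R < s -> Hmeasure s E = 0%E.
Proof.
move=> Is.
have H0 delta : 0 < delta -> Hdelta s delta E = 0%E.
  move=> delta0; apply/eqP; rewrite eq_le; apply/andP; split.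
    apply/lee_addgt0Pr => eps eps0; rewrite add0e.
    have [B Bcov Ble] := exists_small_cover E Is eps0 delta0.
    by apply: ge_ereal_inf; exists (slength s B) => //; exists B.
  by apply: le_ereal_inf_tmp => _ [B _ <-]; apply: slength_ge0.
apply/eqP; rewrite eq_le; apply/andP; split.
  by apply: ge_ereal_sup => _ [delta /H0 -> <-].
by apply: le_ereal_sup_tmp; exists 0%E => //; exists 1; rewrite /= ?H0.
Qed.

End UpperBound.

Theorem theorem1 (F : finFieldType) (R : realType) (m n : nat) :
  (0 < m)%N -> (0 < n)%N ->
  @hausdorff_dim F R _ (@Bad F R m n) = ((m * n)%:R : R)%:E.
Proof.
move=> m0 n0; apply/eqP; rewrite eq_le; apply/andP; split.
  apply/lee_addgt0Pr => eps eps0; apply: ge_ereal_inf.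
  exists ((m * n)%:R + eps)%:E; last by rewrite EFinD.
  exists ((m * n)%:R + eps) => //; split; first by rewrite addr_ge0 // ltW.
  by apply: Hmeasure_eq0; rewrite card_prod !card_ord ltrDl.
(* An exponent s < mn of measure zero is excluded already by the covers with [delta] equal to 1. *)
apply: le_ereal_inf_tmp => _ [s [s0 Hs] <-]; rewrite lee_fin leNgt; apply/negP => smn.
have [c c0 cB] := @slength_Bad_ge F R m n s m0 n0 s0 smn.
have : (c%:E <= Hmeasure s (@Bad F R m n))%E.
  apply: le_ereal_sup_tmp; exists (Hdelta s 1 (@Bad F R m n)).
    by exists 1 => //=.
  by apply: le_ereal_inf_tmp => _ [B /cB h <-].
by rewrite Hs lee_fin leNgt c0.
Qed.
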